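(* Let $H_0$ be a finite dimensional complex Hilbert space, let $p\ge 1$ be an integer, and let $\alpha:\mathcal{B}(H_0)\to\mathcal{B}(H_0)$ be a contractive completely positive map such that $\alpha^p(Y)=0$ for all $Y\in\mathcal{B}(H_0)$. Take $H=\mathbb{C}\oplus H_0$ and $u=\begin{pmatrix} 1 \\ 0 \end{pmatrix}\in H$. Define $\tau:\mathcal{B}(H)\to\mathcal{B}(H)$ by $$\tau\left(\begin{pmatrix} X_{11} & X_{12} \\ X_{21} & X_{22} \end{pmatrix}\right)=\begin{pmatrix} X_{11} & 0 \\ 0 & \alpha(X_{22})+X_{11}(I-\alpha(I)) \end{pmatrix}$$ for all $X=[X_{ij}]\in\mathcal{B}(\mathbb{C}\oplus H_0)$. Then $\tau$ is a completely positive map and $\tau^p(X)=\langle u,Xu\rangle I$ for all $X\in\mathcal{B}(H)$.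
   Context: $\mathcal{B}(H)$ is the algebra of all linear maps on $H$ and $I$ denotes the identity on the relevant space; inner products are anti-linear in the first variable. Operators on $\mathbb{C}\oplus H_0$ are written as $2\times2$ block matrices, with $X_{11}\in\mathcal{B}(\mathbb{C})$ identified with a scalar. Contractive means of norm at most $1$ with respect to the operator norm on $\mathcal{B}(H_0)$. $\alpha^p$ and $\tau^p$ denote $p$-fold compositions. *)

(* Defs.v *)
From HB Require Import structures.
From mathcomp Require Import all_boot all_order all_algebra.
From mathcomp Require Import complex.
From mathcomp Require Import classical_sets reals ereal.
Set Implicit Arguments.
Unset Strict Implicit.
Unset Printing Implicit Defensive.
Import Order.TTheory GRing.Theory Num.Theory Num.Def.
Local Open Scope ring_scope.

(* A finite dimensional complex Hilbert space is a vectType V over R[i], with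
   R : realType, together with a positive definite form f : {dot V for conjC},
   and its algebra of linear maps is 'End(V).  The library's forms are
   antilinear in the SECOND argument, hence the swap below: [inner f] is
   antilinear in the first argument. *)
Definition inner (C : numClosedFieldType) (V : vectType C)
  (f : {dot V for conjC}) (x y : V) : C := f y x.

Section ScalarForm.
Variable C : numClosedFieldType.

Definition cform (x y : C^o) : C := x * conjC y.

Lemma cform_bilinear : bilinear_for *%R (conjC \; *%R) cform.
Proof.
split=> [u a x y|u a x y] /=; rewrite /cform /=.
  by rewrite mulrDl mulrA.
by rewrite rmorphD rmorphM mulrDr mulrCA.
Qed.

Lemma cform_hermitian x y : cform x y = (-1) ^+ false * conjC (cform y x).
Proof. by rewrite mul1r /cform rmorphM /=; rewrite -[X in _ = X]mulrC conjCK. Qed.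

Lemma cform_gt0 x : x != 0 -> 0 < cform x x.
Proof. by move=> x0; rewrite /cform mul_conjC_gt0. Qed.

HB.instance Definition _ :=
  bilinear_isBilinear.Build C C^o C^o C *%R (conjC \; *%R) cform cform_bilinear.
HB.instance Definition _ :=
  isHermitianSesquilinear.Build C C^o false conjC cform cform_hermitian.
HB.instance Definition _ := isDotProduct.Build C C^o cform cform_gt0.

End ScalarForm.

Section DirectSum.
Variables (C : numClosedFieldType) (U V : vectType C).

Section Form.
Variables (f : {dot U for conjC}) (g : {dot V for conjC}).

Definition dsum_form (x y : (U * V)%type) : C := f x.1 y.1 + g x.2 y.2.

Lemma dsum_form_bilinear : bilinear_for *%R (conjC \; *%R) dsum_form.
Proof.
split=> [u a x y|u a x y] /=; rewrite /dsum_form /=.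
  by rewrite !linearDl !linearZl_LR /= mulrDr addrACA.
by rewrite !linearDr !linearZr_LR /= mulrDr addrACA.
Qed.

Lemma dsum_form_hermitian x y :
  dsum_form x y = (-1) ^+ false * conjC (dsum_form y x).
Proof.
rewrite mul1r /dsum_form rmorphD /=.
by rewrite (hermC f) (hermC g) !mul1r.
Qed.

Lemma dsum_form_gt0 x : x != 0 -> 0 < dsum_form x x.
Proof.
case: x => x y; rewrite /dsum_form -pair_eqE negb_and /=.
case/orP => nz; [apply: ltr_wpDr | apply: ltr_wpDl];
  by rewrite ?dnorm_ge0 ?dnorm_gt0.
Qed.

HB.instance Definition _ :=
  bilinear_isBilinear.Build C (U * V)%type (U * V)%type C *%R
    (conjC \; *%R) dsum_form dsum_form_bilinear.
HB.instance Definition _ :=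
  isHermitianSesquilinear.Build C (U * V)%type false conjC dsum_form
    dsum_form_hermitian.
HB.instance Definition _ :=
  isDotProduct.Build C (U * V)%type dsum_form dsum_form_gt0.

End Form.

Definition pr1_op : 'Hom((U * V)%type, U) := linfun (fun x : U * V => x.1).
Definition pr2_op : 'Hom((U * V)%type, V) := linfun (fun x : U * V => x.2).
Definition in1_op : 'Hom(U, (U * V)%type) := linfun (fun x : U => (x, 0 : V)).
Definition in2_op : 'Hom(V, (U * V)%type) := linfun (fun y : V => (0 : U, y)).

Definition block_op (A11 : 'End(U)) (A12 : 'Hom(V, U))
    (A21 : 'Hom(U, V)) (A22 : 'End(V)) : 'End((U * V)%type) :=
  (in1_op \o A11 \o pr1_op)%VF + (in1_op \o A12 \o pr2_op)%VF
  + (in2_op \o A21 \o pr1_op)%VF + (in2_op \o A22 \o pr2_op)%VF.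

Definition blk11 (X : 'End((U * V)%type)) : 'End(U) :=
  (pr1_op \o X \o in1_op)%VF.
Definition blk12 (X : 'End((U * V)%type)) : 'Hom(V, U) :=
  (pr1_op \o X \o in2_op)%VF.
Definition blk21 (X : 'End((U * V)%type)) : 'Hom(U, V) :=
  (pr2_op \o X \o in1_op)%VF.
Definition blk22 (X : 'End((U * V)%type)) : 'End(V) :=
  (pr2_op \o X \o in2_op)%VF.

Lemma pr1_opE x : pr1_op x = x.1.
Proof. by rewrite /pr1_op lfunE. Qed.

Lemma pr2_opE x : pr2_op x = x.2.
Proof. by rewrite /pr2_op lfunE. Qed.

Lemma in1_op_linear : linear (fun x : U => (x, 0 : V)).
Proof.
by move=> a x y; apply/eqP; rewrite -pair_eqE /= scaler0 addr0 !eqxx.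
Qed.

Lemma in2_op_linear : linear (fun y : V => (0 : U, y)).
Proof.
by move=> a x y; apply/eqP; rewrite -pair_eqE /= scaler0 addr0 !eqxx.
Qed.

Lemma in1_opE x : in1_op x = (x, 0).
Proof.
pose h := GRing.isLinear.Build C U (U * V)%type _ _ in1_op_linear.
pose F : {linear U -> (U * V)%type} := HB.pack (fun x : U => (x, 0 : V)) h.
exact: (lfunE F x).
Qed.

Lemma in2_opE y : in2_op y = (0, y).
Proof.
pose h := GRing.isLinear.Build C V (U * V)%type _ _ in2_op_linear.
pose F : {linear V -> (U * V)%type} := HB.pack (fun y : V => (0 : U, y)) h.
exact: (lfunE F y).
Qed.

Lemma block_opE A11 A12 A21 A22 x :
  block_op A11 A12 A21 A22 x = (A11 x.1 + A12 x.2, A21 x.1 + A22 x.2).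
Proof.
rewrite /block_op !add_lfunE !comp_lfunE !in1_opE !in2_opE !pr1_opE !pr2_opE.
by apply/eqP; rewrite -pair_eqE /= !addr0 !add0r !eqxx.
Qed.

Lemma block_op_blk X : block_op (blk11 X) (blk12 X) (blk21 X) (blk22 X) = X.
Proof.
apply/lfunP=> -[x y]; rewrite block_opE !comp_lfunE /= !pr1_opE !pr2_opE.
rewrite in1_opE in2_opE.
have -> : (x, y) = (x, 0) + (0, y) :> (U * V)%type.
  by apply/eqP; rewrite -pair_eqE /= addr0 add0r !eqxx.
by rewrite linearD; apply/eqP; rewrite -pair_eqE /= !eqxx.
Qed.

End DirectSum.

Section Positivity.
Variables (C : numClosedFieldType) (V : vectType C) (f : {dot V for conjC}).

(* Positivity of [A i j] in M_n(B(V)) = B(V^n), written out on V^n. *)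
Definition positive_mx (n : nat) (A : 'M['End(V)]_n) : Prop :=
  forall x : 'I_n -> V, 0 <= \sum_i \sum_j inner f (x i) (A i j (x j)).

Definition completely_positive (phi : 'End(V) -> 'End(V)) : Prop :=
  linear phi /\
  forall (n : nat) (A : 'M['End(V)]_n),
    positive_mx A -> positive_mx (map_mx phi A).

End Positivity.

Section Norms.
Variables (R : realType) (V : vectType R[i]) (f : {dot V for conjC}).
Local Open Scope classical_set_scope.

Definition hilbert_norm (x : V) : R := Num.sqrt (complex.Re (inner f x x)).

(* Suprema are taken in \bar R, so that no boundedness proof is needed for them
   to be meaningful (they are finite, V being finite dimensional). *)
Definition opnorm (A : 'End(V)) : \bar R :=
  ereal_sup [set (hilbert_norm (A x))%:E | x in [set x | hilbert_norm x <= 1]].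

Definition mapnorm (phi : 'End(V) -> 'End(V)) : \bar R :=
  ereal_sup [set opnorm (phi Y) | Y in [set Y | (opnorm Y <= 1)%E]].

Definition contractive (phi : 'End(V) -> 'End(V)) : Prop :=
  (mapnorm phi <= 1)%E.

End Norms.

Section Tau.
Variables (C : numClosedFieldType) (H0 : vectType C).

Definition csum : vectType C := (C^o * H0)%type.

Definition csum_form (f : {dot H0 for conjC}) : {dot csum for conjC} :=
  dsum_form (@cform C) f.

Definition uvec : csum := (1, 0).

(* An operator T on C^o is identified with the scalar T 1. *)
Definition tau (alpha : 'End(H0) -> 'End(H0)) (X : 'End(csum)) : 'End(csum) :=
  block_op (blk11 X) 0 0
    (alpha (blk22 X) + (blk11 X 1 : C) *: (\1%VF - alpha \1%VF)).

End Tau.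

(* Main.v *)
(* Write P = I - alpha(I).  Positivity of alpha(I) and |alpha(I)| <= 1 give
   0 <= <x, alpha(I) x> <= |x|^2 by Cauchy-Schwarz, so P >= 0.  If A = (A_ij) is
   positive, then so are its two diagonal compressions (a_ij), scalar, and
   (D_ij) in M_n(B(H_0)), hence also (alpha(D_ij)); and (a_ij P) is positive
   because diagonalizing (a_ij) makes its quadratic form a combination of values
   <z, P z> with nonnegative coefficients.  For the powers, the lower corner of
   tau^k(X) telescopes to alpha^k(X_22) + X_11 (I - alpha^k(I)). *)

Require Import Defs.
From HB Require Import structures.
From mathcomp Require Import all_boot all_order all_algebra.
From mathcomp Require Import complex.
From mathcomp Require Import classical_sets reals ereal.
From mathcomp Require Import ring.
Set Implicit Arguments.
Unset Strict Implicit.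
Unset Printing Implicit Defensive.
Import Order.TTheory GRing.Theory Num.Theory Num.Def.
Local Open Scope ring_scope.

(** * Spectral decomposition of positive semidefinite scalar matrices *)

Section PositiveSemidefinite.
Variables (C : numClosedFieldType) (n : nat).
Local Open Scope sesquilinear_scope.

(** Realness turns the two hypotheses into [b^* + c^* = b + c] and [b^* - c^* = c - b]; subtracting
    gives twice the claim. *)
Lemma conj_of_real_sums (b c : C) :
  b + c \is Num.real -> 'i * (c - b) \is Num.real -> b = c^*.
Proof.
move=> /CrealP; rewrite rmorphD /= => sum_real.
move=> /CrealP; rewrite rmorphM rmorphB /= conjCi mulNr -mulrN opprB.
move=> /(mulfI (neq0Ci C)) diff_real.
apply: (mulIf (_ : 2 != 0 :> C)); first by rewrite pnatr_eq0.
transitivity ((b + c) - (c - b)); first by ring.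
by rewrite -sum_real -diff_real; ring.
Qed.

(** Polarization: a form that is real on the diagonal has real values at [x + y] and [x + 'i *: y],
    which makes both combinations of the two cross terms in [conj_of_real_sums] real. *)
Lemma hermitian_of_psd (a : 'M[C]_n) :
  (forall u : 'rV[C]_n, 0 <= form conjC a u u) -> a \is hermsymmx.
Proof.
move=> apos; have real_diag u : form conjC a u u \is Num.real.
  exact: ger0_real.
apply/is_hermitianmxP; rewrite expr0 scale1r; apply/matrixP=> i j; rewrite !mxE.
rewrite -(formee conjC a i j) -(formee conjC a j i).
move: (delta_mx 0 i) (delta_mx 0 j) => x y.
apply: conj_of_real_sums.
- have -> : form conjC a x y + form conjC a y x =
    form conjC a (x + y) (x + y) - form conjC a x x - form conjC a y y.
    by rewrite !(formDl, formDr); ring.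
  by rewrite !rpredB.
- have -> : 'i * (form conjC a y x - form conjC a x y) =
    form conjC a (x + 'i *: y) (x + 'i *: y) - form conjC a x x
    - form conjC a y y.
    rewrite !(formDl, formDr, formZl, formZr) /= conjCi mulrA.
    by rewrite mulrN -expr2 sqrCi opprK; ring.
  by rewrite !rpredB.
Qed.

Lemma psd_spectral (a : 'M[C]_n) :
  (forall u : 'rV[C]_n, 0 <= form conjC a u u) ->
  exists (w : 'M[C]_n) (d : 'I_n -> C), (forall k, 0 <= d k) /\
    forall i j, a i j = \sum_k d k * ((w k i)^* * w k j).
Proof.
move=> apos; pose w := spectralmx a; pose d := spectral_diag a.
have wU : w \is unitarymx := spectral_unitarymx a.
have /hermitian_normalmx /orthomx_spectralP := hermitian_of_psd apos.
rewrite -/w -/d invmx_unitary// => aE.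
exists w, (d 0); split=> [k|i j]; last first.
  rewrite aE -mulmxA mxE; apply: eq_bigr => k _.
  by rewrite mul_diag_mx !mxE mulrCA.
(* The rows of the unitary [w] diagonalize the form, so its value at row [k] is the eigenvalue
   [d 0 k]. *)
have := apos (row k w); rewrite (rowE k w) /form trmx_mul map_mxM !mulmxA.
have wawE : w *m a *m w^t* = diag_mx d.
  by rewrite aE !mulmxA (unitarymxP wU) mul1mx -mulmxA (unitarymxP wU) mulmx1.
rewrite -(mulmxA _ w a) -(mulmxA _ (w *m a)) wawE.
by have := formee conjC (diag_mx d) k k; rewrite /form => ->; rewrite mxE eqxx.
Qed.

End PositiveSemidefinite.

(** * From operator norms to inequalities between quadratic forms *)

Section Contractions.

Lemma contraction_quadratic_le (C : numClosedFieldType) (V : vectType C)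
    (f : {dot V for conjC}) (T : 'End(V)) :
  (forall x, f x x <= 1 -> f (T x) (T x) <= 1) ->
  forall x, `|inner f x (T x)| <= f x x.
Proof.
move=> Tball.
have Tle y : f (T y) (T y) <= f y y.
  have [->|y0] := eqVneq y 0; first by rewrite linear0 linear0l.
  have fy0 : 0 < f y y by rewrite dnorm_gt0.
  (* Scaling by the inverse norm puts [y] on the unit sphere, where [Tball] applies; homogeneity
     then gives the bound at [y]. *)
  pose a := (sqrtC (f y y))^-1.
  have a2 : `|a| ^+ 2 = (f y y)^-1.
    by rewrite normfV exprVn ger0_norm ?sqrtC_ge0 ?ltW// sqrtCK.
  have := Tball (a *: y); rewrite [T _]linearZ /= !dnormZ a2 mulVf ?gt_eqF//.
  by move/(_ (lexx _)); rewrite -ler_pdivlMl ?invr_gt0// invrK mulr1.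
(* Squaring brings the goal to the form of Cauchy-Schwarz, after which [Tle] bounds the factor at
   [T x]. *)
move=> x; rewrite -(ler_sqr (x := `|_|)) ?nnegrE ?dnorm_ge0//.
apply: le_trans (CauchySchwarz f (T x) x) _.
by rewrite expr2 ler_wpM2r ?dnorm_ge0.
Qed.

Variables (R : realType) (V : vectType R[i]) (f : {dot V for conjC}).

Lemma hilbert_norm_le1 (x : V) : (hilbert_norm f x <= 1) = (f x x <= 1).
Proof.
rewrite /hilbert_norm /inner -[X in _ <= X]sqrtr1 ler_sqrt//.
by rewrite -lecR RRe_real// ger0_real// dnorm_ge0.
Qed.

(** Trades the extended real supremum and the square root for an inequality in [R[i]]; with bound 1,
    norms and their squares satisfy the same condition. *)
Lemma opnorm_le1P (A : 'End(V)) :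
  (opnorm f A <= 1)%E <-> forall x, f x x <= 1 -> f (A x) (A x) <= 1.
Proof.
split=> [A1 x x1|A1].
  rewrite -hilbert_norm_le1 -lee_fin; apply: le_trans A1.
  by apply: ereal_sup_ubound; exists x => //=; rewrite hilbert_norm_le1.
apply: ge_ereal_sup => _ [x /= x1 <-].
by rewrite lee_fin hilbert_norm_le1 A1// -hilbert_norm_le1.
Qed.

Lemma contractive_opnorm_le1 (phi : 'End(V) -> 'End(V)) (A : 'End(V)) :
  contractive f phi -> (opnorm f A <= 1)%E -> (opnorm f (phi A) <= 1)%E.
Proof.
by move=> phi1 A1; apply: le_trans phi1; apply: ereal_sup_ubound; exists A.
Qed.

Lemma opnorm1_le1 : (opnorm f \1%VF <= 1)%E.
Proof. by apply/opnorm_le1P => x; rewrite id_lfunE. Qed.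

End Contractions.

(** * Positive matrices of operators: scalar multiples, compressions, block sums *)

Section PositiveMatrices.
Variable C : numClosedFieldType.

Lemma positive_mx_scale_psd (V : vectType C) (f : {dot V for conjC}) (n : nat)
    (a : 'M[C]_n) (T : 'End(V)) :
  (forall u : 'rV[C]_n, 0 <= form conjC a u u) ->
  (forall x, 0 <= inner f x (T x)) ->
  positive_mx f (\matrix_(i, j) (a i j *: T)).
Proof.
move=> /psd_spectral[w [d [d_ge0 aE]]] Tpos x.
(* These are the coordinates in which the scalar matrix becomes diagonal: row [k] of [w] applied to
   the tuple [x]. *)
pose z k := \sum_j w k j *: x j.
suff -> : \sum_i \sum_j inner f (x i) ((\matrix_(i, j) (a i j *: T)) i j (x j))
    = \sum_k d k * inner f (z k) (T (z k)).
  by apply: sumr_ge0 => k _; rewrite mulr_ge0.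
transitivity (\sum_i \sum_j \sum_k
    d k * ((w k i)^* * w k j * inner f (x i) (T (x j)))).
  apply: eq_bigr => i _; apply: eq_bigr => j _.
  rewrite mxE scale_lfunE /inner linearZl_LR /= aE mulr_suml.
  by apply: eq_bigr => k _; rewrite !mulrA.
under eq_bigr => i _ do rewrite exchange_big /=.
rewrite exchange_big /=; apply: eq_bigr => k _.
rewrite /inner /z linear_sumr mulr_sumr; apply: eq_bigr => i _.
rewrite linearZr_LR /= linear_sum linear_sumlz /= !mulr_sumr.
apply: eq_bigr => j _; rewrite [T (_ *: _)]linearZ /= linearZl_LR /=.
by rewrite !mulrA.
Qed.

Section Blocks.
Variables (U V : vectType C) (f : {dot U for conjC}) (g : {dot V for conjC}).
Variable n : nat.

(** Compression amounts to testing positivity only on tuples from the first summand. *)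
Lemma positive_mx_blk11 (A : 'M['End((U * V)%type)]_n) :
  positive_mx (dsum_form f g) A -> positive_mx f (map_mx (@blk11 _ U V) A).
Proof.
move=> Apos x; have := Apos (fun i => (x i, 0)).
congr (0 <= _); apply: eq_bigr => i _; apply: eq_bigr => j _.
by rewrite mxE !comp_lfunE in1_opE pr1_opE /inner /= /dsum_form linear0r addr0.
Qed.

Lemma positive_mx_blk22 (A : 'M['End((U * V)%type)]_n) :
  positive_mx (dsum_form f g) A -> positive_mx g (map_mx (@blk22 _ U V) A).
Proof.
move=> Apos x; have := Apos (fun i => (0, x i)).
congr (0 <= _); apply: eq_bigr => i _; apply: eq_bigr => j _.
by rewrite mxE !comp_lfunE in2_opE pr2_opE /inner /= /dsum_form linear0r add0r.
Qed.

(** The summands are orthogonal, so the quadratic form splits as a sum over the two coordinates. *)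
Lemma positive_mx_block_diag (A : 'M['End(U)]_n) (B : 'M['End(V)]_n) :
  positive_mx f A -> positive_mx g B ->
  positive_mx (dsum_form f g) (\matrix_(i, j) block_op (A i j) 0 0 (B i j)).
Proof.
move=> Apos Bpos x; have := addr_ge0 (Apos (fst \o x)) (Bpos (snd \o x)).
congr (0 <= _); rewrite -big_split; apply: eq_bigr => i _.
rewrite -big_split; apply: eq_bigr => j _.
by rewrite mxE block_opE !zero_lfunE addr0 add0r.
Qed.

End Blocks.

Lemma End_scalarE (T : 'End(C^o)) (c : C) : T c = c * (T 1 : C).
Proof. by rewrite -[in LHS](mulr1 c) -[c * 1]/(c *: (1 : C^o)) linearZ. Qed.

Lemma psd_of_positive_scalar_mx (n : nat) (A : 'M['End(C^o)]_n) :
  positive_mx (@cform C) A ->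
  forall u : 'rV[C]_n,
    0 <= form conjC (\matrix_(i, j) (A i j 1 : C)) u u.
Proof.
(* [form] conjugates its second vector whereas [inner] conjugates its first, hence the conjugated
   entries. *)
move=> Apos u; have := Apos (fun i => (u 0 i)^*).
congr (0 <= _); rewrite /form mxE.
rewrite exchange_big; apply: eq_bigr => j _; rewrite !mxE mulr_suml.
apply: eq_bigr => i _; rewrite mxE -[LHS]/((A i j (u 0 j)^* : C) * (u 0 i)^*^*).
rewrite (End_scalarE _ (u 0 j)^*) conjCK.
by rewrite mulrC mulrA mulrAC.
Qed.

End PositiveMatrices.

(** * The blocks of [tau], its iterates and its complete positivity *)

Section Tau.
Variables (C : numClosedFieldType) (H0 : vectType C).
Implicit Types (alpha : 'End(H0) -> 'End(H0)) (X : 'End(csum H0)).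

Lemma tau_linear alpha : linear alpha -> linear (tau alpha).
Proof.
move=> alin a X Y; apply/lfunP=> x.
have D11 : blk11 (a *: X + Y) = a *: blk11 X + blk11 Y.
  by rewrite /blk11 !(comp_lfunDl, comp_lfunDr) -comp_lfunZr -comp_lfunZl.
have D22 : blk22 (a *: X + Y) = a *: blk22 X + blk22 Y.
  by rewrite /blk22 !(comp_lfunDl, comp_lfunDr) -comp_lfunZr -comp_lfunZl.
rewrite /tau D11 D22 alin; move: (\1%VF - alpha \1%VF) => defect.
rewrite [RHS]add_lfunE [X in _ = X + _]scale_lfunE !block_opE.
apply/eqP; rewrite -pair_eqE /=; apply/andP; split.
  by rewrite !zero_lfunE !addr0 add_lfunE scale_lfunE.
rewrite !zero_lfunE !add0r !(add_lfunE, scale_lfunE) /=.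
rewrite [a *: (blk11 X 1 : C^o)]/(a * (blk11 X 1 : C)).
by rewrite scalerDl scalerDr scalerA addrACA.
Qed.

Lemma blk11_tau alpha X : blk11 (tau alpha X) = blk11 X.
Proof.
apply/lfunP => x.
by rewrite 2![LHS]comp_lfunE in1_opE pr1_opE block_opE /= linear0 addr0.
Qed.

Lemma blk22_tau alpha X :
  blk22 (tau alpha X)
  = alpha (blk22 X) + (blk11 X 1 : C) *: (\1%VF - alpha \1%VF).
Proof.
apply/lfunP => x.
by rewrite 2![LHS]comp_lfunE in2_opE pr2_opE block_opE /= linear0 add0r.
Qed.

Lemma blk11_iter_tau alpha k X : blk11 (iter k (tau alpha) X) = blk11 X.
Proof. by elim: k => //= k IH; rewrite blk11_tau. Qed.

Lemma blk22_iter_tau alpha k X : linear alpha ->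
  blk22 (iter k (tau alpha) X)
  = iter k alpha (blk22 X)
    + (blk11 X 1 : C) *: (\1%VF - iter k alpha \1%VF).
Proof.
move=> alin.
pose al : {linear 'End(H0) -> 'End(H0)} :=
  HB.pack alpha (GRing.isLinear.Build C 'End(H0) 'End(H0) _ _ alin).
elim: k => [|k IH] /=; first by rewrite subrr scaler0 addr0.
rewrite blk22_tau IH blk11_iter_tau -[alpha]/(al : _ -> _).
rewrite (linearD al) (linearZ_LR al) (linearB al) /= -addrA -scalerDr.
(* The telescoping: the two occurrences of [alpha \1%VF] cancel. *)
by congr (_ + _ *: _); rewrite addrC addrA subrK.
Qed.

Lemma tau_uvecE (f : {dot H0 for conjC}) X :
  inner (csum_form f) (uvec H0) (X (uvec H0)) = blk11 X 1.
Proof.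
rewrite -[LHS]/(((X (uvec H0)).1 : C) * (1 : C)^* + f (X (uvec H0)).2 0).
by rewrite linear0r addr0 conjC1 mulr1 !comp_lfunE in1_opE pr1_opE.
Qed.

Lemma iter_tau_nilpotent alpha p X : linear alpha ->
  (forall Y, iter p.+1 alpha Y = 0) ->
  iter p.+1 (tau alpha) X = (blk11 X 1 : C) *: \1%VF.
Proof.
move=> alin nil; apply/lfunP => x.
rewrite -[in LHS](block_op_blk (iter _ _ _)) blk11_iter_tau blk22_iter_tau//.
rewrite !nil subr0 add0r block_opE scale_lfunE id_lfunE.
(* The exponent is a successor, so an outermost [tau] annihilates the off-diagonal corners. *)
have -> : blk12 (iter p.+1 (tau alpha) X) = 0.
  apply/lfunP=> y; rewrite iterS /blk12 !comp_lfunE in2_opE pr1_opE block_opE /=.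
  by rewrite linear0 !zero_lfunE addr0.
have -> : blk21 (iter p.+1 (tau alpha) X) = 0.
  apply/lfunP=> y; rewrite iterS /blk21 !comp_lfunE in1_opE pr2_opE block_opE /=.
  by rewrite linear0 !zero_lfunE addr0.
rewrite !zero_lfunE addr0 add0r scale_lfunE id_lfunE.
by apply/eqP; rewrite -pair_eqE /= eqxx andbT End_scalarE mulrC.
Qed.

(** The image of a positive matrix is block diagonal, so its two corners are treated separately; the
    lower one is a sum of two positive matrices. *)
Lemma tau_completely_positive (f : {dot H0 for conjC}) alpha :
  completely_positive f alpha ->
  (forall x, 0 <= inner f x ((\1%VF - alpha \1%VF) x)) ->
  completely_positive (csum_form f) (tau alpha).
Proof.
move=> [alin acp] defect_pos; split=> [|n A Apos]; first exact: tau_linear.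
have A11 := positive_mx_blk11 Apos.
have Aalpha := acp _ _ (positive_mx_blk22 Apos).
have Adefect := positive_mx_scale_psd
  (psd_of_positive_scalar_mx A11) defect_pos.
have A22 : positive_mx f (\matrix_(i, j) (alpha (blk22 (A i j))
    + (blk11 (A i j) 1 : C) *: (\1%VF - alpha \1%VF))).
  move=> x; have := addr_ge0 (Aalpha x) (Adefect x).
  congr (0 <= _); rewrite -big_split; apply: eq_bigr => i _.
  rewrite -big_split; apply: eq_bigr => j _.
  by rewrite !mxE add_lfunE /inner linearDl.
have := positive_mx_block_diag A11 A22.
by congr (positive_mx _ _); apply/matrixP => i j; rewrite !mxE.
Qed.

End Tau.

Unset Implicit Arguments.
Set Strict Implicit.
Set Printing Implicit Defensive.

Theorem theorem4p3 (R : realType) (H0 : vectType R[i])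
    (f : {dot H0 for conjC}) (p : nat) (alpha : 'End(H0) -> 'End(H0)) :
  (1 <= p)%N ->
  completely_positive f alpha ->
  contractive f alpha ->
  (forall Y : 'End(H0), iter p alpha Y = 0) ->
  completely_positive (csum_form f) (tau alpha) /\
  (forall X : 'End(csum H0),
     iter p (tau alpha) X
     = inner (csum_form f) (uvec H0) (X (uvec H0)) *: \1%VF).
Proof.
case: p => // p _ acp acontr nil; split=> [|X]; last first.
  by rewrite tau_uvecE; apply: iter_tau_nilpotent => //; case: acp.
apply: tau_completely_positive => // x.
(* Complete positivity on the 1 by 1 matrix with entry the identity. *)
have alpha1_pos : 0 <= inner f x (alpha \1%VF x).
  have := acp.2 1 (const_mx \1%VF) _ (fun=> x).
  rewrite !big_ord1 !mxE; apply=> y.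
  by rewrite !big_ord1 mxE id_lfunE /inner dnorm_ge0.
(* Positivity of [alpha \1%VF] removes the absolute value from the quadratic bound, leaving exactly
   positivity of the defect. *)
have := contractive_opnorm_le1 acontr (opnorm1_le1 f).
move=> /opnorm_le1P/contraction_quadratic_le/(_ x).
rewrite ger0_norm// /inner add_lfunE opp_lfunE id_lfunE linearDl linearNl.
by rewrite subr_ge0.
Qed.
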